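(* Consider a noncooperative kinetically constrained lattice gas on the box $\Lambda=[L]^d$ with empty boundary conditions and with reservoirs on the boundary, and fix a mobile cluster $\mathcal C$ with $N=|\mathcal C|$ sites. There is a constant $C>0$, depending only on the model (dimension, rates) and on the chosen mobile cluster, but not on $q$ or $L$, such that for every $q\in(0,1)$, every $L\in\mathbb N$ and every $f:\{0,1\}^\Lambda\to\mathbb R$, $$\operatorname{Var}_\mu f\le C\,q^{-N-1}L^2\,\mathcal D_{\mathrm r}f,$$ where $\mu$ is the product Bernoulli measure on $\{0,1\}^\Lambda$ (each site occupied with probability $1-q$) and $$\mathcal D_{\mathrm r}f=\mu\Big[\sum_{x,y\in\Lambda,\,x\sim y}c_{x,y}(\nabla_{x,y}f)^2\Big]+\mu\Big[\sum_{x\in\partial\Lambda}c_x(\nabla_xf)^2\Big],\qquad c_x(\eta)=q\eta(x)+(1-q)(1-\eta(x)).$$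
   Context: Let $d\ge1$ and let $e_1,\dots,e_d$ be the standard basis of $\mathbb Z^d$. Sites $x,y$ are neighbours, $x\sim y$, if $x-y\in\{\pm e_1,\dots,\pm e_d\}$. A configuration is $\eta\in\Omega=\{0,1\}^{\mathbb Z^d}$; site $x$ is empty if $\eta(x)=0$ and occupied if $\eta(x)=1$. $\eta^{x,y}$ denotes $\eta$ with the values at $x,y$ exchanged, $\eta^x$ denotes $\eta$ with the value at $x$ flipped, $\nabla_{x,y}f(\eta)=f(\eta^{x,y})-f(\eta)$, $\nabla_xf(\eta)=f(\eta^x)-f(\eta)$. For a permutation $\sigma$ of $\mathbb Z^d$, $(\sigma\eta)(y)=\eta(\sigma^{-1}(y))$; $(x_1,\dots,x_n)$ denotes a cyclic permutation; $\tau_x$ is the translation $y\mapsto y+x$. A kinetically constrained lattice gas (KCLG) is given by rates $c_{x,y}:\Omega\to\{0\}\cup[1,c_{\max}]$ ($x\sim y$, some $c_{\max}\ge1$) such that: $c_{x,y}(\eta)$ does not depend on $\eta(x),\eta(y)$; for every edge there are $\eta,\eta'$ with $c_{x,y}(\eta)\ge1$ and $c_{x,y}(\eta')=0$; $c_{x,y}$ is coordinatewise nonincreasing in $\eta$; $c_{x,y}(\eta)=c_{x+z,y+z}(\tau_z\eta)$ for all $z$; and $c_{x,y}$ depends only on $\eta$ restricted to $x+[-R,R]^d$ for some fixed $R$. Its generator is $\mathcal Lf=\sum_{x\sim y}c_{x,y}\nabla_{x,y}f$. For $q\in(0,1)$, $\mu=\mu_q$ is the product measure under which each site is independently occupied with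 probability $1-q$. A $T$-step move $M$ with domain $\mathrm{Dom}M\subseteq\Omega$ consists of maps $\eta_t:\mathrm{Dom}M\to\Omega$ ($0\le t\le T$), $x_t:\mathrm{Dom}M\to\mathbb Z^d$ and $e_t:\mathrm{Dom}M\to\{\pm e_1,\dots,\pm e_d\}$ ($0\le t<T$) with $\eta_0(\eta)=\eta$ and, for each $t<T$, $\eta_{t+1}=\eta_t^{x_t,x_t+e_t}$ and $c_{x_t,x_t+e_t}(\eta_t)\ge1$. It is deterministic if $x_t,e_t$ do not depend on $\eta$. It is compatible with a permutation $\sigma$ if for every $\eta\in\mathrm{Dom}M$ the product of transpositions $(x_{T-1},x_{T-1}+e_{T-1})\cdots(x_0,x_0+e_0)$ equals $\sigma$. For a finite $\mathcal C\subset\mathbb Z^d$, $l>0$ and $e\in\{\pm e_1,\dots,\pm e_d\}$: a translation move of $\mathcal C$ in direction $e$ in $[-l,l]^d$ is a deterministic move with domain $\{\eta:\mathcal C\text{ is empty}\}$, compatible with a permutation $\sigma$ satisfying $\sigma(y)=y+e$ for all $y\in\mathcal C$, with $x_t,x_t+e_t\in[-l,l]^d$ for all $t$. An exchange move using $\mathcal C$ in direction $e$ in $[-l,l]^d$ is a deterministic move with domain $\{\eta:\mathcal C\text{ is empty}\}$, compatible with the transposition of $le$ and $(l+1)e$, with $x_t,x_t+e_t\in[-l,l]^d\cup\{(l+1)e\}$ for all $t$. $\mathcal C$ is a mobile cluster if for some $l>0$ both moves exist for all $2d$ directions $e$. The KCLG is noncooperative if a mobile cluster exists. On the box $\Lambda=[L]^d$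 with empty boundary conditions, the rate $c_{x,y}(\eta)$ for $\eta\in\{0,1\}^\Lambda$, $x,y\in\Lambda$, means $c_{x,y}(\bar\eta)$ where $\bar\eta=\eta$ on $\Lambda$ and $\bar\eta=0$ outside $\Lambda$. $\partial\Lambda$ is the set of sites of $\Lambda$ having a neighbour outside $\Lambda$. The dynamics with reservoirs has generator $\mathcal L_{\mathrm r}f=\sum_{x,y\in\Lambda,x\sim y}c_{x,y}\nabla_{x,y}f+\sum_{x\in\partial\Lambda}c_x\nabla_xf$, with $c_x$ as in the claim. *)

(* Defs.v *)
From HB Require Import structures.
From mathcomp Require Import all_boot all_order all_algebra.
From mathcomp Require Import reals.
Set Implicit Arguments.
Unset Strict Implicit.
Unset Printing Implicit Defensive.
Import Order.TTheory GRing.Theory Num.Theory.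
Local Open Scope ring_scope.

Definition site (d : nat) := {ffun 'I_d -> int}.
Definition config (d : nat) := site d -> bool.   (* Omega = {0,1}^{Z^d}; true = occupied *)

Definition sadd d (x y : site d) : site d := [ffun j => x j + y j].
Definition ssub d (x y : site d) : site d := [ffun j => x j - y j].
Definition dir d (i : 'I_d) (b : bool) : site d :=
  [ffun j => if j == i then (if b then 1 else -1) else 0].
Definition ldir d (l : int) (i : 'I_d) (b : bool) : site d :=
  [ffun j => if j == i then (if b then l else - l) else 0].
Definition nbr d (x y : site d) : Prop := exists i b, y = sadd x (dir i b).

Definition translate d (z : site d) (eta : config d) : config d :=
  fun y => eta (ssub y z).
Definition swap d (eta : config d) (x y : site d) : config d :=
  fun z => if z == x then eta y else if z == y then eta x else eta z.
Definition transp d (a b z : site d) : site d :=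
  if z == a then b else if z == b then a else z.
Definition in_box d (x : site d) (r : int) (z : site d) : bool :=
  [forall j, (x j - r <= z j) && (z j <= x j + r)].
Definition in_cube d (l : int) (z : site d) : bool :=
  [forall j, (- l <= z j) && (z j <= l)].

Definition is_KCLG (R : realType) d (c : site d -> site d -> config d -> R) : Prop :=
  (exists cmax : R, 1 <= cmax /\
     forall x y eta, nbr x y -> c x y eta = 0 \/ (1 <= c x y eta /\ c x y eta <= cmax))
  /\ (forall x y eta eta', nbr x y ->
        (forall z, z != x -> z != y -> eta z = eta' z) -> c x y eta = c x y eta')
  /\ (forall x y, nbr x y -> exists eta eta', 1 <= c x y eta /\ c x y eta' = 0)
  /\ (forall x y eta eta', nbr x y -> (forall z, eta z ==> eta' z) ->
        c x y eta' <= c x y eta)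
  /\ (forall x y z eta, nbr x y ->
        c x y eta = c (sadd x z) (sadd y z) (translate z eta))
  /\ (exists r : nat, forall x y eta eta', nbr x y ->
        (forall z, in_box x r%:Z z -> eta z = eta' z) -> c x y eta = c x y eta').

(* a step (x_t, e_t) with e_t = dir i b *)
Definition step d := (site d * ('I_d * bool))%type.
Definition target d (st : step d) : site d := sadd st.1 (dir st.2.1 st.2.2).

Fixpoint legal (R : realType) d (c : site d -> site d -> config d -> R)
    (eta : config d) (s : seq (step d)) : Prop :=
  match s with
  | [::] => True
  | st :: s' => 1 <= c st.1 (target st) eta /\
                legal c (swap eta st.1 (target st)) s'
  end.

(* the product (x_{T-1},x_{T-1}+e_{T-1}) ... (x_0,x_0+e_0), as a map *)
Fixpoint perm_of d (s : seq (step d)) (z : site d) : site d :=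
  match s with
  | [::] => z
  | st :: s' => perm_of s' (transp st.1 (target st) z)
  end.

Definition empty_on d (Cl : seq (site d)) (eta : config d) : Prop :=
  forall y, y \in Cl -> eta y = false.

Definition translation_move (R : realType) d (c : site d -> site d -> config d -> R)
    (Cl : seq (site d)) (i : 'I_d) (b : bool) (l : nat) (s : seq (step d)) : Prop :=
  (forall eta, empty_on Cl eta -> legal c eta s)
  /\ (forall y, y \in Cl -> perm_of s y = sadd y (dir i b))
  /\ (forall st, st \in s -> in_cube l%:Z st.1 && in_cube l%:Z (target st)).

Definition exchange_move (R : realType) d (c : site d -> site d -> config d -> R)
    (Cl : seq (site d)) (i : 'I_d) (b : bool) (l : nat) (s : seq (step d)) : Prop :=
  (forall eta, empty_on Cl eta -> legal c eta s)
  /\ (forall z, perm_of s z = transp (ldir l%:Z i b) (ldir (l.+1)%:Z i b) z)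
  /\ (forall st, st \in s ->
        (in_cube l%:Z st.1 || (st.1 == ldir (l.+1)%:Z i b)) &&
        (in_cube l%:Z (target st) || (target st == ldir (l.+1)%:Z i b))).

Definition mobile_cluster (R : realType) d (c : site d -> site d -> config d -> R)
    (Cl : seq (site d)) : Prop :=
  exists l : nat, (0 < l)%N /\ forall (i : 'I_d) (b : bool),
    (exists s, translation_move c Cl i b l s) /\ (exists s, exchange_move c Cl i b l s).

Definition boxT d L := {ffun 'I_d -> 'I_L}.
Definition emb d L (x : boxT d L) : site d := [ffun j => ((x j : nat) : int)].
Definition bconf d L := {ffun boxT d L -> bool}.
Definition ext d L (eta : bconf d L) : config d :=
  fun z => [exists x : boxT d L, (emb x == z) && eta x].
Definition bnbr d L (x y : boxT d L) : bool :=
  [exists i, exists b, emb y == sadd (emb x) (dir i b)].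
Definition boundary d L (x : boxT d L) : bool :=
  [exists i, exists b, ~~ [exists y : boxT d L, emb y == sadd (emb x) (dir i b)]].
Definition bswap d L (eta : bconf d L) (x y : boxT d L) : bconf d L :=
  [ffun z => if z == x then eta y else if z == y then eta x else eta z].
Definition bflip d L (eta : bconf d L) (x : boxT d L) : bconf d L :=
  [ffun z => if z == x then ~~ eta x else eta z].

Definition mu (R : realType) d L (q : R) (eta : bconf d L) : R :=
  \prod_(x : boxT d L) (if eta x then 1 - q else q).
Definition Emu (R : realType) d L (q : R) (F : bconf d L -> R) : R :=
  \sum_(eta : bconf d L) mu q eta * F eta.
Definition Var (R : realType) d L (q : R) (f : bconf d L -> R) : R :=
  Emu q (fun eta => (f eta - Emu q f) ^+ 2).
Definition cres (R : realType) d L (q : R) (eta : bconf d L) (x : boxT d L) : R :=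
  if eta x then q else 1 - q.
Definition Dr (R : realType) d L (c : site d -> site d -> config d -> R) (q : R)
    (f : bconf d L -> R) : R :=
  Emu q (fun eta => \sum_(x : boxT d L) \sum_(y : boxT d L | bnbr x y)
                      c (emb x) (emb y) (ext eta) * (f (bswap eta x y) - f eta) ^+ 2)
  + Emu q (fun eta => \sum_(x : boxT d L | boundary x)
                      cres q eta x * (f (bflip eta x) - f eta) ^+ 2).

(* Main.v *)
From mathcomp Require Import perm.
Require Import Defs.
From HB Require Import structures.
From mathcomp Require Import all_boot all_order all_algebra.
From mathcomp Require Import reals.
From mathcomp Require Import boolp.
From mathcomp Require Import zify ring lra.
Set Implicit Arguments.
Unset Strict Implicit.
Unset Printing Implicit Defensive.
Import Order.TTheory GRing.Theory Num.Theory.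
Local Open Scope ring_scope.

(** By the Efron-Stein inequality, [Var f] is at most the sum over the sites [u]
    of the box of the flip energies [mu (c_u (nabla_u f)^2)]. Give the sites
    outside the box independent Bernoulli occupations as well: this flip energy
    is then the mean square of [f eta^{u,y} - f eta] for any outer site [y].
    Take [y] just outside the box on the line through [u] in a fixed direction,
    and a translate of the mobile cluster further out on that line. This cluster
    is empty with probability [q^N], independently of the increment of [f], and
    when it is empty it can exchange [u] and [y] in O(L) legal steps, travelling
    along the line. On the box, a step inside is a legal swap (monotonicity of
    the rates lets us empty the outside), a step across the boundary is a flip
    by the reservoir, and a step outside does nothing. Each step preserves the
    measure; Cauchy-Schwarz along the path costs a factor O(L), and summing over
    [u] uses every edge O(L) times. *)

(** * Bernoulli product measure on a finite set of sites *)

Section Bernoulli.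
Variables (R : realType) (q : R).

(** This and the next definitions have the bodies of [mu], [Emu], [bflip] and [cres], but over any
    finite type: the results then hold for the box by conversion, and also for larger sets of
    sites. *)
Definition bernoulli (S : finType) (eta : {ffun S -> bool}) : R :=
  \prod_(x : S) (if eta x then 1 - q else q).

Definition expect (S : finType) (F : {ffun S -> bool} -> R) : R :=
  \sum_(eta : {ffun S -> bool}) bernoulli eta * F eta.

Definition flip (S : finType) (eta : {ffun S -> bool}) (x : S) : {ffun S -> bool} :=
  [ffun z => if z == x then ~~ eta x else eta z].

Definition flip_rate (S : finType) (eta : {ffun S -> bool}) (x : S) : R :=
  if eta x then q else 1 - q.

Definition swap_sites (S : finType) (eta : {ffun S -> bool}) (x y : S) :
  {ffun S -> bool} := [ffun z => eta (tperm x y z)].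


Section OneSpace.
Variable S : finType.
Implicit Types (eta : {ffun S -> bool}) (F G : {ffun S -> bool} -> R).

Lemma flipK x : involutive (fun eta => flip eta x).
Proof.
move=> eta; apply/ffunP => z; rewrite !ffunE eqxx negbK.
by case: eqP => [->|].
Qed.

Lemma flipC eta x y : flip (flip eta x) y = flip (flip eta y) x.
Proof.
apply/ffunP => z; rewrite !ffunE.
have [-> //|xy] := eqVneq x y; have [->|zy] := eqVneq z y.
  by rewrite ?(eq_sym y x) ?(negbTE xy).
by case: (z == x).
Qed.

(** Detailed balance: [flip_rate] is the weight of the value not held at [x], so both sides are
    [q * (1 - q)] times the weight of the other sites. *)
Lemma bernoulli_flip eta x :
  bernoulli (flip eta x) * flip_rate (flip eta x) x = bernoulli eta * flip_rate eta x.
Proof.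
rewrite /bernoulli /flip_rate (bigD1 x) //= [in RHS](bigD1 x) //= !ffunE eqxx.
rewrite (eq_bigr (fun z => if eta z then 1 - q else q)).
  by case: (eta x) => /=; ring.
by move=> z zx; rewrite ffunE (negbTE zx).
Qed.

Lemma bernoulli_swap eta x y : bernoulli (swap_sites eta x y) = bernoulli eta.
Proof.
rewrite /bernoulli [RHS](reindex_inj (@perm_inj _ (tperm x y))).
by apply: eq_bigr => z _; rewrite ffunE.
Qed.

Lemma swap_sitesK x y : involutive (fun eta => swap_sites eta x y).
Proof. by move=> eta; apply/ffunP => z; rewrite !ffunE tpermK. Qed.

Lemma eq_expect F G : F =1 G -> expect F = expect G.
Proof. by move=> FG; apply: eq_bigr => eta _; rewrite FG. Qed.

Lemma expectD F G : expect (fun eta => F eta + G eta) = expect F + expect G.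
Proof. by rewrite -big_split; apply: eq_bigr => eta _; rewrite mulrDr. Qed.

Lemma expectZ a F : expect (fun eta => a * F eta) = a * expect F.
Proof. by rewrite mulr_sumr; apply: eq_bigr => eta _; rewrite mulrCA. Qed.

Lemma expect_sum (I : Type) (r : seq I) (P : pred I) (F : I -> {ffun S -> bool} -> R) :
  expect (fun eta => \sum_(i <- r | P i) F i eta) = \sum_(i <- r | P i) expect (F i).
Proof.
rewrite [RHS]exchange_big; apply: eq_bigr => eta _ /=.
by rewrite mulr_sumr.
Qed.

Lemma expect_swap F x y : expect (fun eta => F (swap_sites eta x y)) = expect F.
Proof.
rewrite [RHS](reindex_inj (can_inj (swap_sitesK x y))).
by apply: eq_bigr => eta _; rewrite bernoulli_swap.
Qed.

Lemma expect_flip F x :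
  expect (fun eta => flip_rate eta x * F (flip eta x)) =
  expect (fun eta => flip_rate eta x * F eta).
Proof.
rewrite [RHS](reindex_inj (can_inj (flipK x))).
by apply: eq_bigr => eta _; rewrite !mulrA bernoulli_flip.
Qed.

Lemma expect1 : expect (fun _ : {ffun S -> bool} => 1) = 1.
Proof.
rewrite /expect; under eq_bigr do rewrite mulr1.
rewrite /bernoulli -(bigA_distr_bigA (fun (x : S) (b : bool) => if b then 1 - q else q)).
by rewrite big1 // => x _; rewrite big_bool /=; ring.
Qed.

Lemma expect_cst a : expect (fun _ : {ffun S -> bool} => a) = a.
Proof.
by rewrite -[RHS]mulr1 -expect1 -expectZ; apply: eq_expect => eta; rewrite mulr1.
Qed.

(** Independence of [eta x] and [F]. The contributions of the two values at [x] sum to [expect F],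
    and reversibility of the flip fixes their ratio. *)
Lemma expect_site_eq F x b : (forall eta, F (flip eta x) = F eta) ->
  expect (fun eta => (eta x == b)%:R * F eta) = (if b then 1 - q else q) * expect F.
Proof.
move=> Fx.
pose X c := expect (fun eta => (eta x == c)%:R * F eta).
have sumX : X b + X (~~ b) = expect F.
  rewrite -expectD; apply: eq_expect => eta.
  by case: (eta x); case: (b) => /=; ring.
have bal : (if b then q else 1 - q) * X b = (if b then 1 - q else q) * X (~~ b).
  rewrite -!expectZ.
  have -> : expect (fun eta => (if b then q else 1 - q) * ((eta x == b)%:R * F eta)) =
            expect (fun eta => flip_rate eta x * ((eta x == b)%:R * F eta)).
    apply: eq_expect => eta; rewrite /flip_rate.
    by case: (eqVneq (eta x) b) => [->|_]; rewrite ?mul0r ?mulr0.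
  rewrite -expect_flip; apply: eq_expect => eta.
  by rewrite Fx /flip_rate ffunE eqxx; case: (eta x); case: (b) => /=; ring.
rewrite -/(X b) -sumX mulrDr -bal.
by case: (b); ring.
Qed.

End OneSpace.
End Bernoulli.

(** * Single-site resampling and the Efron-Stein inequality *)

Section EfronStein.
Variables (R : realType) (q : R) (S : finType).
Implicit Types (eta : {ffun S -> bool}) (F G : {ffun S -> bool} -> R).

(** The conditional expectation of [F] given the sites other than [x]: the opposite value at [x] has
    probability [flip_rate]. *)
Definition resample (x : S) F eta : R :=
  F eta + flip_rate q eta x * (F (flip eta x) - F eta).

Lemma flip_rate_flip eta x y : flip_rate q (flip eta x) y =
  if y == x then 1 - flip_rate q eta x else flip_rate q eta y.
Proof.
rewrite /flip_rate !ffunE; case: (y == x) => //.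
by case: (eta x) => /=; ring.
Qed.

Lemma resample_flip x F eta : resample x F (flip eta x) = resample x F eta.
Proof. by rewrite /resample flipK flip_rate_flip eqxx; ring. Qed.

Lemma resample_flip_invariant x y F : (forall eta, F (flip eta y) = F eta) ->
  forall eta, resample x F (flip eta y) = resample x F eta.
Proof.
move=> Fy eta; have [->|xy] := eqVneq y x; first exact: resample_flip.
by rewrite /resample flipC !Fy flip_rate_flip eq_sym (negbTE xy).
Qed.

Lemma resampleC x y F eta :
  resample x (resample y F) eta = resample y (resample x F) eta.
Proof.
have [->//|xy] := eqVneq x y.
rewrite /resample !flip_rate_flip (flipC _ y x) (negbTE xy) eq_sym (negbTE xy).
ring.
Qed.

Lemma resampleB x F G eta :
  resample x (fun eta => F eta - G eta) eta = resample x F eta - resample x G eta.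
Proof. by rewrite /resample; ring. Qed.

Lemma expect_resample x F : expect q (resample x F) = expect q F.
Proof.
rewrite expectD -[RHS]addr0; congr (_ + _).
transitivity (expect q (fun eta => flip_rate q eta x * F (flip eta x)) +
              -1 * expect q (fun eta => flip_rate q eta x * F eta)).
  by rewrite -expectZ -expectD; apply: eq_expect => eta; ring.
by rewrite expect_flip; ring.
Qed.

(** Pythagoras for the orthogonal projection [resample x]. The mixed term vanishes because
    [resample x F] is blind to [x] and factors out of [resample x G]. *)
Lemma expect_sqr_resample x F : expect q (fun eta => F eta ^+ 2) =
  expect q (fun eta => resample x F eta ^+ 2) +
  expect q (fun eta => (F eta - resample x F eta) ^+ 2).
Proof.
pose G eta := resample x F eta * F eta.
have : expect q (resample x G) - expect q G = 0 by rewrite expect_resample subrr.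
have -> : expect q (resample x G) - expect q G =
    expect q (fun eta => resample x F eta * (resample x F eta - F eta)).
  rewrite -mulN1r -expectZ -expectD; apply: eq_expect => eta.
  by rewrite {1}/resample {1 2}/G resample_flip /G /resample; ring.
move=> G0; rewrite -expectD -[LHS]addr0 -[X in _ + X](mulr0 2) -G0 -expectZ -expectD.
by apply: eq_expect => eta; ring.
Qed.

Hypothesis q01 : 0 <= q <= 1.

Lemma bernoulli_ge0 eta : 0 <= bernoulli q eta.
Proof.
by have /andP[q0 q1] := q01; apply: prodr_ge0 => x _; case: ifP => _; lra.
Qed.

Lemma flip_rate_ge0 eta x : 0 <= flip_rate q eta x.
Proof. by have /andP[q0 q1] := q01; rewrite /flip_rate; case: ifP => _; lra. Qed.

Lemma le_expect F G : (forall eta, F eta <= G eta) -> expect q F <= expect q G.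
Proof. by move=> FG; apply: ler_sum => eta _; rewrite ler_wpM2l // bernoulli_ge0. Qed.

Lemma expect_ge0 F : (forall eta, 0 <= F eta) -> 0 <= expect q F.
Proof. by move=> F0; apply: sumr_ge0 => eta _; rewrite mulr_ge0 // bernoulli_ge0. Qed.

Definition local_var x F : R := expect q (fun eta => (F eta - resample x F eta) ^+ 2).

Lemma local_var_le_flip x F : local_var x F <=
  expect q (fun eta => flip_rate q eta x * (F (flip eta x) - F eta) ^+ 2).
Proof.
apply: le_expect => eta; rewrite /resample opprD addNKr sqrrN exprMn.
rewrite ler_wpM2r ?sqr_ge0 //; have /andP[q0 q1] := q01.
by rewrite /flip_rate; case: ifP => _; nra.
Qed.

(** Resamplings commute, so the left side is the squared norm of the projection by [resample x] of
    [F - resample y F]. *)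
Lemma local_var_resample x y F : local_var y (resample x F) <= local_var y F.
Proof.
rewrite [X in _ <= X](expect_sqr_resample x) -[X in X <= _]addr0.
apply: lerD; last by apply: expect_ge0 => eta; exact: sqr_ge0.
by rewrite le_eqVlt; apply/orP; left; apply/eqP/eq_expect => eta;
   rewrite resampleB resampleC.
Qed.

Definition resample_seq (s : seq S) F := foldl (fun G x => resample x G) F s.

(** Pythagoras once per site; the local variances of the partly resampled functions are brought back
    to those of [F] by [local_var_resample]. *)
Lemma expect_sqr_resample_seq s F :
  expect q (fun eta => F eta ^+ 2) - expect q (fun eta => resample_seq s F eta ^+ 2)
  <= \sum_(x <- s) local_var x F.
Proof.
elim: s F => [|x s IH] F; first by rewrite big_nil subrr.
rewrite big_cons (expect_sqr_resample x F) -/(local_var x F) /=.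
have le_s : \sum_(y <- s) local_var y (resample x F) <= \sum_(y <- s) local_var y F.
  by apply: ler_sum => y _; exact: local_var_resample.
by have := IH (resample x F); rewrite /resample_seq /=; lra.
Qed.

Lemma expect_resample_seq s F : expect q (resample_seq s F) = expect q F.
Proof. by elim: s F => //= x s IH F; rewrite IH expect_resample. Qed.

Lemma resample_seq_flip s F y : y \in s ->
  forall eta, resample_seq s F (flip eta y) = resample_seq s F eta.
Proof.
have inv t G : (forall eta, G (flip eta y) = G eta) ->
    forall eta, resample_seq t G (flip eta y) = resample_seq t G eta.
  by elim: t G => //= x t IH G Gy; apply: IH; exact: resample_flip_invariant.
elim: s F => //= x s IH F; rewrite inE => /predU1P[yx|/IH //].
by apply: (inv s (resample x F)) => eta; rewrite yx resample_flip.
Qed.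

(** Induction on a list containing every site of disagreement: one flip, if needed, removes its
    head. *)
Lemma flip_invariant_cst F : (forall eta x, F (flip eta x) = F eta) ->
  forall eta eta', F eta = F eta'.
Proof.
move=> Finv; suff agree (s : seq S) eta eta' :
    (forall x, x \notin s -> eta x = eta' x) -> F eta = F eta'.
  by move=> eta eta'; apply: (agree (enum S)) => x; rewrite mem_enum.
elim: s eta => [|x s IH] eta eta_eq.
  by congr F; apply/ffunP => x; exact: eta_eq.
have [ex|nex] := eqVneq (eta x) (eta' x).
  apply: IH => z zs; have [->//|zx] := eqVneq z x.
  by apply: eta_eq; rewrite inE negb_or zx.
rewrite -(Finv eta x); apply: IH => z zs; rewrite ffunE.
have [->|zx] := eqVneq z x; first by move: nex; case: (eta x); case: (eta' x).
by apply: eta_eq; rewrite inE negb_or zx.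
Qed.

Lemma efron_stein F :
  expect q (fun eta => (F eta - expect q F) ^+ 2) <=
  \sum_(x : S) expect q (fun eta => flip_rate q eta x * (F (flip eta x) - F eta) ^+ 2).
Proof.
(* Once every site is resampled no dependence is left, and the constant is the mean because
   resampling preserves it. *)
have cst : forall eta, resample_seq (enum S) F eta = expect q F.
  move=> eta; rewrite -(expect_resample_seq (enum S) F) -[LHS](@expect_cst R q S).
  apply: eq_expect => eta'; apply: flip_invariant_cst => zeta x.
  by apply: resample_seq_flip; rewrite mem_enum.
have := expect_sqr_resample_seq (enum S) F.
under [expect q (fun eta => resample_seq _ _ _ ^+ 2)]eq_expect do rewrite cst.
rewrite expect_cst big_enum /= => le_var.
have -> : expect q (fun eta => (F eta - expect q F) ^+ 2) =
    expect q (fun eta => F eta ^+ 2) - expect q F ^+ 2.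
  set m := expect q F.
  rewrite -[in RHS](@expect_cst R q S (m ^+ 2)).
  transitivity (expect q (fun eta => F eta ^+ 2) + (- 2 * m) * expect q F +
                expect q (fun _ : {ffun S -> bool} => m ^+ 2)).
    by rewrite -expectZ -!expectD; apply: eq_expect => eta; ring.
  by rewrite expect_cst -/m; ring.
by apply: le_trans le_var _; apply: ler_sum => x _; exact: local_var_le_flip.
Qed.

End EfronStein.

(** Marginals of a product measure: the sum over each fibre of the restriction map factorizes, and
    sites off the image of [j] contribute [q + (1 - q) = 1]. *)
Lemma expect_restrict (R : realType) (q : R) (A B : finType) (j : A -> B) :
  injective j -> forall F : {ffun A -> bool} -> R,
  expect q (fun eta : {ffun B -> bool} => F [ffun a => eta (j a)]) = expect q F.
Proof.
move=> j_inj F; pose rst (eta : {ffun B -> bool}) := [ffun a => eta (j a)].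
rewrite /expect (partition_big rst predT) //=; apply: eq_bigr => zeta _.
rewrite (eq_bigr (fun eta => bernoulli q eta * F zeta)); last first.
  by move=> eta /eqP <-.
rewrite -mulr_suml; congr (_ * _).
(* [Q b] prescribes the value at [b] on the image of [j] and is vacuous elsewhere, so the fibre over
   [zeta] is a product set. *)
pose Q (b : B) (v : bool) := [forall a, (j a == b) ==> (v == zeta a)].
rewrite (eq_bigl (fun eta => eta \in family Q)); last first.
  move=> eta; apply/eqP/familyP => [ez b|fam].
    by apply/forallP => a; apply/implyP => /eqP <-; rewrite -ez ffunE.
  apply/ffunP => a; rewrite ffunE.
  by have /forallP /(_ a) := fam (j a); rewrite eqxx => /eqP.
rewrite /bernoulli.
rewrite -(bigA_distr_big_dep Q (fun _ b => if b then 1 - q else q)).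
rewrite (bigID (mem (j @: [set: A]))) /= mulrC big1 ?mul1r; last first.
  move=> b bj; rewrite (eq_bigl predT) ?big_bool /= => [|v]; first by ring.
  apply/forallP => a; apply/implyP => /eqP jab.
  by move: bj; rewrite -jab imset_f // inE.
rewrite big_imset /=; last by move=> a a' _ _; exact: j_inj.
rewrite (eq_bigl predT); last by move=> a; rewrite inE.
apply: eq_bigr => a _; rewrite (eq_bigl (pred1 (zeta a))) ?big_pred1_eq // => v /=.
apply/forallP/eqP => [/(_ a)|-> a']; first by rewrite eqxx => /eqP.
by apply/implyP => /eqP /j_inj ->.
Qed.

(** * Legal words of steps and the long-range exchange along a line *)

Section Words.
Variables (d : nat).
Implicit Types (eta : config d) (x y z a b : site d) (s : seq (step d)).

Lemma saddE x y : sadd x y = x + y.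
Proof. by apply/ffunP => j; rewrite !ffunE. Qed.

Lemma ssubE x y : ssub x y = x - y.
Proof. by apply/ffunP => j; rewrite !ffunE. Qed.

Lemma site_addE x y j : (x + y) j = x j + y j.
Proof. by rewrite ffunE. Qed.

Fixpoint act eta s : config d :=
  if s is st :: s' then act (swap eta st.1 (target st)) s' else eta.

Definition shift z s : seq (step d) := [seq (st.1 + z, st.2) | st <- s].

Definition avoids a s : Prop := forall st, st \in s -> st.1 != a /\ target st != a.

Lemma size_shift z s : size (shift z s) = size s.
Proof. exact: size_map. Qed.

Lemma swapK eta x y : swap (swap eta x y) x y = eta.
Proof.
apply: funext => z; rewrite /swap !eqxx.
have [->|zx] := eqVneq z x; first by case: eqVneq => // ->.
by case: eqVneq => // ->.
Qed.

Lemma swap_sym eta x y : swap eta x y = swap eta y x.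
Proof.
apply: funext => z; rewrite /swap.
by case: eqVneq => [->|_]; case: eqVneq => // ->.
Qed.

Lemma swap_transp eta x y z : swap eta x y (transp x y z) = eta z.
Proof.
rewrite /swap /transp.
have [->|zx] := eqVneq z x; first by rewrite eqxx; case: eqVneq => // ->.
have [->|zy] := eqVneq z y; first by rewrite eqxx.
by rewrite (negbTE zx) (negbTE zy).
Qed.

Lemma transpK a b : involutive (transp a b).
Proof.
move=> z; rewrite /transp.
have [->|za] := eqVneq z a; first by rewrite eqxx; case: eqVneq.
have [->|zb] := eqVneq z b; first by rewrite eqxx.
by rewrite (negbTE za) (negbTE zb).
Qed.

Lemma swapC eta x y a b : x != a -> x != b -> y != a -> y != b ->
  swap (swap eta x y) a b = swap (swap eta a b) x y.
Proof.
move=> xa xb ya yb; apply: funext => z; rewrite /swap.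
rewrite (negbTE xa) (negbTE xb) (negbTE ya) (negbTE yb).
rewrite !(eq_sym a) !(eq_sym b) (negbTE xa) (negbTE xb) (negbTE ya) (negbTE yb).
have [->|za] := eqVneq z a.
  by rewrite !(eq_sym a) (negbTE xa) (negbTE ya).
have [->|zb] := eqVneq z b.
  by rewrite !(eq_sym b) (negbTE xb) (negbTE yb).
by case: (z == x); case: (z == y).
Qed.

Lemma swap_conj eta x y z : x != y -> x != z -> y != z ->
  swap (swap (swap eta x y) y z) x y = swap eta x z.
Proof.
move=> xy xz yz; apply: funext => w; rewrite /swap !eqxx.
rewrite !(eq_sym y x) !(eq_sym z) (negbTE xy) (negbTE xz) (negbTE yz).
have [//|wx] := eqVneq w x.
by have [->|wy] := eqVneq w y; rewrite ?(negbTE yz).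
Qed.

Lemma act_cat eta s1 s2 : act eta (s1 ++ s2) = act (act eta s1) s2.
Proof. by elim: s1 eta => //= st s1 IH eta. Qed.

Lemma act_perm_of eta s z : act eta s (perm_of s z) = eta z.
Proof. by elim: s eta z => //= st s IH eta z; rewrite IH swap_transp. Qed.

(** Contents travel along [perm_of], so the final configuration is read through the inverse
    permutation; a transposition is its own inverse. *)
Lemma act_of_transp eta s a b : (forall z, perm_of s z = transp a b z) ->
  act eta s = swap eta a b.
Proof.
move=> perm_s; apply: funext => z.
by rewrite -{1}[z](transpK a b) -perm_s act_perm_of -{2}[z](transpK a b) swap_transp.
Qed.

(** The last step that moves the content ends at its final place. This locates the images of the
    cluster sites inside the cube of the translation move. *)
Lemma perm_of_moved s y : perm_of s y != y ->
  exists2 st, st \in s & (perm_of s y == st.1) || (perm_of s y == target st).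
Proof.
elim: s y => [|st s IH] y /=; first by rewrite eqxx.
set y' := transp _ _ _; have [py'|/IH[st' st's ty]] := eqVneq (perm_of s y') y'.
  rewrite py' => y'y; exists st; rewrite ?inE ?eqxx //.
  move: y'y; rewrite /y' /transp.
  have [_|_] := eqVneq y st.1; first by rewrite eqxx orbT.
  by have [_|_] := eqVneq y (target st); rewrite eqxx.
by exists st'; rewrite // inE st's orbT.
Qed.

Lemma act_shift eta z s u : act eta (shift z s) (u + z) = act (fun v => eta (v + z)) s u.
Proof.
elim: s eta => //= st s IH eta; rewrite IH; congr (act _ s u).
apply: funext => v; rewrite /swap /target /= !saddE addrAC.
by rewrite !(inj_eq (addIr z)).
Qed.

Lemma act_swap_avoids eta s a b : avoids a s -> avoids b s ->
  act (swap eta a b) s = swap (act eta s) a b.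
Proof.
elim: s eta => //= st s IH eta ha hb.
have [a1 a2] := ha st (mem_head _ _); have [b1 b2] := hb st (mem_head _ _).
rewrite swapC 1?eq_sym // 1?eq_sym // IH //.
- by move=> st' st's; apply: ha; rewrite inE st's orbT.
- by move=> st' st's; apply: hb; rewrite inE st's orbT.
Qed.

Variables (R : realType) (c : site d -> site d -> config d -> R).
Hypothesis kclg : is_KCLG c.

Lemma nbr_target (st : step d) : nbr st.1 (target st).
Proof. by exists st.2.1, st.2.2. Qed.

Lemma legal_cat eta s1 s2 : legal c eta s1 -> legal c (act eta s1) s2 ->
  legal c eta (s1 ++ s2).
Proof. by elim: s1 eta => //= st s1 IH eta [? ls1] ls2; split=> //; exact: IH. Qed.

Lemma rate_swap eta x y : nbr x y -> c x y (swap eta x y) = c x y eta.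
Proof.
have [_ [indep _]] := kclg; move=> xy; apply: indep => // z zx zy.
by rewrite /swap (negbTE zx) (negbTE zy).
Qed.

(** A rate ignores the occupations of its own two sites, so each swap is legally undone by
    itself. *)
Lemma legal_rev eta s : legal c eta s ->
  legal c (act eta s) (rev s) /\ act (act eta s) (rev s) = eta.
Proof.
elim: s eta => //= st s IH eta [cst /IH[lr ar]].
rewrite rev_cons -cats1 act_cat ar /= swapK; split=> //.
apply: legal_cat => //; rewrite ar /=; split=> //.
by rewrite rate_swap //; exact: nbr_target.
Qed.

Lemma legal_shift eta z s : legal c (fun v => eta (v + z)) s -> legal c eta (shift z s).
Proof.
elim: s eta => //= st s IH eta [cst ls].
have [_ [_ [_ [_ [transl _]]]]] := kclg; split.
  move: cst; rewrite (transl _ _ z _ (nbr_target st)) !saddE.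
  congr (1 <= c _ _ _); first by rewrite /target /= !saddE addrAC.
  by apply: funext => v; rewrite /translate ssubE subrK.
apply: IH; set eta1 := (fun v => _).
suff -> : eta1 = swap (fun v => eta (v + z)) st.1 (target st) by [].
rewrite /eta1; apply: funext => v.
rewrite /swap /target /= !saddE addrAC.
by rewrite !(inj_eq (addIr z)).
Qed.

Variables (Cl : seq (site d)) (i : 'I_d) (l : nat) (tau E : seq (step d)).
Hypothesis tauP : translation_move c Cl i true l tau.
Hypothesis EP : exchange_move c Cl i true l E.

Local Notation e := (dir i true).

(** Numbered from [l], so that [line z 0] and [line z 1] are the two sites exchanged by
    [shift z E]. *)
Definition line z (k : nat) : site d := z + ldir (l + k)%:Z i true.

Lemma line_coord z k : line z k i = z i + (l + k)%:Z.
Proof. by rewrite !ffunE eqxx. Qed.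

Lemma line_shift z k : line (z + e) k = line z k.+1.
Proof.
apply/ffunP => j; rewrite !ffunE; case: (j == i); last by rewrite !addr0.
by rewrite -addrA; congr (_ + _); lia.
Qed.

Lemma line_neq z k k' : k != k' -> line z k != line z k'.
Proof.
by move=> kk'; apply/eqP => /(congr1 (fun x : site d => x i)); rewrite !line_coord; lia.
Qed.

(** The translation moves the content of [y] to [y + e], which is therefore touched by a step and
    lies in the cube. Hence the cluster stays strictly behind the line. *)
Lemma cluster_coord y : y \in Cl -> y i + 1 <= l%:Z.
Proof.
move=> yC; have [_ [tr cube]] := tauP.
have ye : perm_of tau y != y.
  rewrite tr //; apply/eqP => /(congr1 (fun x : site d => x i)).
  by rewrite !ffunE eqxx; lia.
have [st st_tau touched] := perm_of_moved ye.
have yei : perm_of tau y i = y i + 1 by rewrite tr // !ffunE eqxx.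
have /andP[/forallP/(_ i)/andP[_ c1] /forallP/(_ i)/andP[_ c2]] := cube _ st_tau.
by rewrite -yei; case/orP: touched => /eqP ->.
Qed.

Lemma line_not_cluster z k y : y \in Cl -> y + z != line z k.
Proof.
move=> yC; apply/eqP => /(congr1 (fun x : site d => x i)).
by rewrite line_coord site_addE; have := cluster_coord yC; lia.
Qed.

(** Site [k] of the line has coordinate [l + k] relative to [z], beyond the cube of the translation.
    Site 0 lies in this cube, hence [0 < k]. *)
Lemma tau_avoids_line z k : (0 < k)%N -> avoids (line z k) (shift z tau).
Proof.
move=> k0 st /mapP[[x0 [i0 b0]] st0_tau ->]; have [_ [_ cube]] := tauP.
have /andP[/forallP/(_ i)/andP[_ /= c1] /forallP/(_ i)/andP[_]] := cube _ st0_tau.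
rewrite /target /= saddE site_addE => c2.
split; apply/eqP => /(congr1 (fun x : site d => x i)).
  by rewrite line_coord site_addE; lia.
by rewrite line_coord saddE !site_addE; lia.
Qed.

Fixpoint exchange_word z (n : nat) : seq (step d) :=
  if n is n'.+1 then
    shift z E ++ shift z tau ++ exchange_word (z + e) n' ++ rev (shift z tau) ++ shift z E
  else shift z E.

Definition cluster_empty_at z eta := forall y, y \in Cl -> eta (y + z) = false.

Lemma cluster_empty_swap z eta k k' : cluster_empty_at z eta ->
  cluster_empty_at z (swap eta (line z k) (line z k')).
Proof.
move=> em y yC; rewrite /swap.
by rewrite (negbTE (line_not_cluster z k yC)) (negbTE (line_not_cluster z k' yC)) em.
Qed.

Lemma exchange_shiftP z eta : cluster_empty_at z eta ->
  legal c eta (shift z E) /\ act eta (shift z E) = swap eta (line z 0) (line z 1).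
Proof.
have [lE [pE _]] := EP; move=> em; split; first by apply: legal_shift; apply: lE.
apply: funext => u; rewrite -[u](subrK z) act_shift (act_of_transp _ pE) /swap.
rewrite /line addn0 addn1 ![z + _]addrC.
by rewrite !(inj_eq (addIr z)).
Qed.

Lemma translation_shiftP z eta : cluster_empty_at z eta ->
  legal c eta (shift z tau) /\ cluster_empty_at (z + e) (act eta (shift z tau)).
Proof.
have [lt [pt _]] := tauP; move=> em; split; first by apply: legal_shift; apply: lt.
move=> y yC; rewrite [z + e]addrC addrA act_shift -saddE -pt //.
by rewrite act_perm_of em.
Qed.

(* Conjugating the exchange of the sites 1 and n + 2 of the line, done by the
   cluster moved one step forward, by the exchange of 0 and 1. The translation
   does not touch the sites 1, 2, ... of the line, so that undoing it is legal
   also after the inner exchange. *)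
Lemma exchange_wordP n z eta : cluster_empty_at z eta ->
  legal c eta (exchange_word z n) /\
  act eta (exchange_word z n) = swap eta (line z 0) (line z n.+1).
Proof.
elim: n z eta => [|n IH] z eta em; first exact: exchange_shiftP.
have [l1 a1] := exchange_shiftP em.
set eta1 := swap eta _ _ in a1; have em1 : cluster_empty_at z eta1.
  exact: cluster_empty_swap.
have [l2 em2] := translation_shiftP em1.
have [] := IH _ _ em2; rewrite !line_shift => l3 a3.
set eta1' := swap eta1 (line z 1) (line z n.+2).
have em1' : cluster_empty_at z eta1' by exact: cluster_empty_swap.
have a3' : act eta1' (shift z tau) = swap (act eta1 (shift z tau)) (line z 1) (line z n.+2).
  by apply: act_swap_avoids; apply: tau_avoids_line.
have [l2' _] := translation_shiftP em1'.
have [l4 a4] := legal_rev l2'.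
have [l5 a5] := exchange_shiftP em1'.
have a5' : swap eta1' (line z 0) (line z 1) = swap eta (line z 0) (line z n.+2).
  by apply: swap_conj; apply: line_neq.
rewrite /= !act_cat a1 a3 -a3' a4 a5 a5'; split=> //.
apply: legal_cat; rewrite ?a1 //; apply: legal_cat => //; apply: legal_cat => //.
by rewrite a3 -a3'; apply: legal_cat => //; rewrite a4.
Qed.

(** One level of [exchange_word], up to order and translation; the last level consists of its first
    factor alone. *)
Definition unit_word : seq (step d) := E ++ tau ++ rev tau ++ E.

Lemma size_exchange_word z n : (size (exchange_word z n) <= n.+1 * size unit_word)%N.
Proof.
rewrite /unit_word; elim: n z => [|n IH] z /=.
  by rewrite size_shift mul1n size_cat leq_addr.
rewrite mulSn !size_cat !size_rev !size_shift.
by have := IH (z + e); rewrite !size_cat !size_rev; lia.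
Qed.

(** The cluster stops at [z + e *+ k], and each stop uses translated letters of [unit_word], whose
    order does not affect a sum. The letters missing at the last stop are added by nonnegativity. *)
Lemma sum_exchange_word (h : step d -> R) z n : (forall st, 0 <= h st) ->
  \sum_(st <- exchange_word z n) h st <=
  \sum_(k < n.+1) \sum_(st <- unit_word) h (st.1 + z + e *+ k, st.2).
Proof.
move=> h0; have sum_ge0 (s : seq (step d)) (g : step d -> step d) :
    0 <= \sum_(st <- s) h (g st) by apply: sumr_ge0.
elim: n z => [|n IH] z.
  rewrite big_ord1 /unit_word big_cat /= big_map mulr0n.
  rewrite (eq_bigr (fun st => h (st.1 + z + 0, st.2))); last by move=> st; rewrite addr0.
  by rewrite lerDl; exact: (sum_ge0 _ (fun st => (_, st.2))).
rewrite big_ord_recl /=; set A := \sum_(st <- unit_word) _; set B := \sum_(k < _) _.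
have -> : A = \sum_(st <- unit_word) h (st.1 + z, st.2).
  by apply: eq_bigr => st _; rewrite mulr0n addr0.
have {}IH : \sum_(st <- exchange_word (z + e) n) h st <= B.
  apply: le_trans (IH (z + e)) _; rewrite le_eqVlt; apply/orP; left; apply/eqP.
  apply: eq_bigr => k _; apply: eq_bigr => st _.
  by rewrite addrA -[st.1 + z + e + _]addrA -mulrS.
have sum_rev (s : seq (step d)) (g : step d -> R) :
    \sum_(st <- rev s) g st = \sum_(st <- s) g st.
  by apply: perm_big; rewrite perm_rev.
rewrite /unit_word !big_cat /= !sum_rev !big_map.
by move: IH; rewrite -!addrA; lra.
Qed.

End Words.

Lemma emb_inj d L : injective (@emb d L).
Proof.
move=> x y /ffunP exy; apply/ffunP => j; apply/val_inj.
by have := exy j; rewrite !ffunE => -[].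
Qed.

(** * Random occupations on a finite window containing the box *)

Section FiniteVolume.
Variables (R : realType) (q : R) (d L : nat).
Hypothesis q01 : 0 <= q <= 1.
Implicit Types (eta : config d) (x y z : site d).

Definition box_conf eta : bconf d L := [ffun u => eta (emb u)].
Definition in_lattice z := [exists u : boxT d L, emb u == z].

Lemma box_conf_agree eta eta' : (forall z, in_lattice z -> eta z = eta' z) ->
  box_conf eta = box_conf eta'.
Proof.
move=> ag; apply/ffunP => u; rewrite !ffunE ag //.
by apply/existsP; exists u.
Qed.

Lemma box_conf_swap eta (u v : boxT d L) :
  box_conf (swap eta (emb u) (emb v)) = bswap (box_conf eta) u v.
Proof. by apply/ffunP => w; rewrite !ffunE /swap !(inj_eq (@emb_inj d L)). Qed.

Lemma box_conf_swap_out eta x y : ~~ in_lattice x -> ~~ in_lattice y ->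
  box_conf (swap eta x y) = box_conf eta.
Proof.
move=> xo yo; apply: box_conf_agree => z zi; rewrite /swap.
by case: eqVneq zi xo => [-> ->|_ zi _] //; case: eqVneq zi yo => [-> ->|].
Qed.

Lemma box_conf_swap_boundary eta (u : boxT d L) y : ~~ in_lattice y ->
  box_conf (swap eta (emb u) y) =
  if box_conf eta u == eta y then box_conf eta else bflip (box_conf eta) u.
Proof.
move=> yo; apply/ffunP => w; rewrite !ffunE /swap (inj_eq (@emb_inj d L)).
have -> : (emb w == y) = false.
  by apply/negP => wy; move/negP: yo; apply; apply/existsP; exists w.
case: (eqVneq (eta (emb u)) (eta y)) => [<-|ne]; rewrite !ffunE.
  by case: eqVneq => // ->.
by case: ifP => // _; move: ne; case: (eta y); case: (eta (emb u)).
Qed.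

Variable sl : seq (site d).
Hypothesis sl_box : forall u : boxT d L, emb u \in sl.

(** Randomness is confined to a finite list [sl], to contain the box and all sites met by a path, so
    that expectations remain finite sums; sites off [sl] are empty. *)
Definition lift_conf (zeta : {ffun seq_sub sl -> bool}) : config d :=
  fun z => if insub z is Some a then zeta a else false.

Definition expect_on (F : config d -> R) : R :=
  expect q (fun zeta => F (lift_conf zeta)).

Lemma lift_conf_val zeta (a : seq_sub sl) : lift_conf zeta (val a) = zeta a.
Proof. by rewrite /lift_conf valK. Qed.

Lemma lift_conf_swap zeta (a b : seq_sub sl) :
  swap (lift_conf zeta) (val a) (val b) = lift_conf (swap_sites zeta a b).
Proof.
apply: funext => z; rewrite /swap !lift_conf_val {2}/lift_conf /lift_conf.
case: insubP => [w _ wz|zsl].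
  rewrite ffunE -wz !(inj_eq val_inj).
  by case: tpermP => [->|->|/eqP/negbTE -> /eqP/negbTE ->]; rewrite ?eqxx //;
     case: eqVneq => // ->.
case: eqVneq zsl => [->|_]; first by rewrite (valP a).
by case: eqVneq => // ->; rewrite (valP b).
Qed.

Lemma expect_on_swap F x y : x \in sl -> y \in sl ->
  expect_on (fun eta => F (swap eta x y)) = expect_on F.
Proof.
move=> xs ys; pose a : seq_sub sl := SeqSub xs; pose b : seq_sub sl := SeqSub ys.
rewrite -[RHS](expect_swap q _ a b); apply: eq_expect => zeta.
by rewrite -lift_conf_swap.
Qed.

Lemma expect_on_box (F : bconf d L -> R) :
  expect_on (fun eta => F (box_conf eta)) = expect q F.
Proof.
pose j u : seq_sub sl := SeqSub (sl_box u).
have j_inj : injective j by move=> u v /(congr1 val) /emb_inj.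
rewrite -(expect_restrict q j_inj F); apply: eq_expect => zeta.
by congr F; apply/ffunP => u; rewrite !ffunE -[emb u]/(val (j u)) lift_conf_val.
Qed.

Definition ignores (A : seq (site d)) (F : config d -> R) :=
  forall eta eta', (forall z, z \notin A -> eta z = eta' z) -> F eta = F eta'.

Lemma expect_on_site F z b : z \in sl -> ignores [:: z] F ->
  expect_on (fun eta => (eta z == b)%:R * F eta) =
  (if b then 1 - q else q) * expect_on F.
Proof.
move=> zs Fz; pose a : seq_sub sl := SeqSub zs.
rewrite -(@expect_site_eq R q _ (fun zeta => F (lift_conf zeta)) a b).
  by apply: eq_expect => zeta; rewrite -[z]/(val a) lift_conf_val.
move=> zeta; apply: Fz => w; rewrite inE => wz; rewrite /lift_conf.
case: insubP => // w' _ w'w; rewrite ffunE; case: eqVneq => // w'a.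
by move: wz; rewrite -w'w w'a eqxx.
Qed.

Lemma expect_on_empty F (A : seq (site d)) : uniq A -> {subset A <= sl} ->
  ignores A F ->
  expect_on (fun eta => (all (fun z => ~~ eta z) A)%:R * F eta) =
  q ^+ size A * expect_on F.
Proof.
elim: A F => [|z A IH] F /=.
  by move=> _ _ _; rewrite mul1r; apply: eq_expect => zeta; rewrite mul1r.
case/andP=> zA uA sA FA.
have -> : expect_on (fun eta => (~~ eta z && all (fun w => ~~ eta w) A)%:R * F eta) =
    expect_on (fun eta => (eta z == false)%:R *
                          ((all (fun w => ~~ eta w) A)%:R * F eta)).
  apply: eq_expect => zeta; rewrite eqbF_neg.
  by case: (~~ lift_conf zeta z); rewrite ?mul1r ?mul0r.
rewrite expect_on_site ?IH ?exprS ?mulrA //.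
- by move=> w wA; apply: sA; rewrite inE wA orbT.
- by move=> eta eta' ag; apply: FA => w; rewrite inE negb_or => /andP[_]; exact: ag.
- by apply: sA; exact: mem_head.
move=> eta eta' ag; congr (_%:R * _).
  congr (nat_of_bool _); apply: eq_in_all => w wA; rewrite ag // inE.
  by apply: contraNneq zA => <-.
by apply: FA => w; rewrite inE negb_or => /andP[wz _]; apply: ag; rewrite inE.
Qed.

(** The outer site acts as a reservoir: the swap flips [u] exactly when [y] holds the other value,
    an event of probability [flip_rate] given the box. *)
Lemma expect_on_boundary (f : bconf d L -> R) (u : boxT d L) y :
  y \in sl -> ~~ in_lattice y ->
  expect_on (fun eta => (f (box_conf (swap eta (emb u) y)) - f (box_conf eta)) ^+ 2) =
  expect q (fun eta : bconf d L => flip_rate q eta u * (f (flip eta u) - f eta) ^+ 2).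
Proof.
move=> ys yo; pose D (g : bconf d L) := (f (flip g u) - f g) ^+ 2.
(* The squared increment when [y] has value [b]; it depends on the box only. *)
pose F b eta := (box_conf eta u != b)%:R * D (box_conf eta).
have Fy b : ignores [:: y] (F b).
  move=> eta eta' ag; rewrite /F (_ : box_conf eta = box_conf eta') //.
  apply: box_conf_agree => z zi; apply: ag; rewrite inE.
  by apply: contraNneq yo => <-.
rewrite -(expect_on_box (fun g => flip_rate q g u * D g)).
transitivity (expect_on (fun eta => (eta y == true)%:R * F true eta) +
              expect_on (fun eta => (eta y == false)%:R * F false eta)).
  rewrite -expectD; apply: eq_expect => zeta; set eta := lift_conf zeta.
  rewrite box_conf_swap_boundary // /F.
  by case: (eta y); case: (box_conf eta u) => /=;
     rewrite ?subrr ?expr0n ?mul0r ?mul1r ?mulr0 ?addr0 ?add0r.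
rewrite !expect_on_site // -!expectZ -expectD; apply: eq_expect => zeta.
by rewrite /F /flip_rate; case: (box_conf _ u) => /=; ring.
Qed.

End FiniteVolume.

(** Cauchy-Schwarz for a sum of increments, in the form of one induction step. *)
Lemma sqr_add_le (R : realFieldType) (n : nat) (a b B : R) :
  b ^+ 2 <= n%:R * B -> 0 <= B -> (a + b) ^+ 2 <= n.+1%:R * (a ^+ 2 + B).
Proof.
case: n => [|n] bB B0.
  have -> : b = 0.
    by apply/eqP; rewrite -sqrf_eq0; apply/eqP/le_anti; rewrite sqr_ge0 andbT; lra.
  by rewrite addr0; lra.
have n0 : 0 < n.+1%:R :> R by rewrite ltr0n.
rewrite -[n.+2]add1n natrD; set N := n.+1%:R in n0 bB *.
(* After multiplication of the goal by [N], the difference of its sides is this square plus the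
   slack in [bB']. *)
have sq := sqr_ge0 (N * a - b).
rewrite -(ler_pM2l n0).
have bB' : (N + 1) * b ^+ 2 <= (N + 1) * (N * B) by rewrite ler_wpM2l //; lra.
nra.
Qed.

Lemma sum_eq_inj_le1 (R : realFieldType) (I : finType) (T : eqType) (g : I -> T) (t : T) :
  injective g -> \sum_(w : I) (t == g w)%:R <= 1 :> R.
Proof.
move=> g_inj; have [/existsP[w /eqP tw]|/existsPn nw] := boolP [exists w, t == g w].
  rewrite (bigD1 w) //= big1 ?addr0 => [|v vw].
    by case: (t == g w).
  by rewrite tw (inj_eq g_inj) eq_sym (negbTE vw).
by rewrite big1 // => w _; rewrite (negbTE (nw w)).
Qed.

(** * Comparison of flip energies with the Dirichlet form along a path *)

Section Energy.
Variables (R : realType) (q : R) (d L : nat).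
Variables (c : site d -> site d -> config d -> R) (f : bconf d L -> R).
Hypothesis q01 : 0 <= q <= 1.
Hypothesis kclg : is_KCLG c.
Implicit Types (eta : config d) (x y z : site d) (st : step d) (u v : boxT d L).

Definition swap_energy u v : R := expect q (fun eta : bconf d L =>
  c (emb u) (emb v) (ext eta) * (f (bswap eta u v) - f eta) ^+ 2).

Definition flip_energy u : R := expect q (fun eta : bconf d L =>
  flip_rate q eta u * (f (flip eta u) - f eta) ^+ 2).

Lemma bnbrP u v : bnbr u v -> nbr (emb u) (emb v).
Proof. by case/existsP=> i /existsP[b /eqP ->]; exists i, b. Qed.

Lemma rate_ge0 x y eta : nbr x y -> 0 <= c x y eta.
Proof.
have [[cmax [_ cb]] _] := kclg; move=> /(cb x y eta)[-> //|[c1 _]].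
exact: le_trans ler01 c1.
Qed.

Lemma swap_energy_ge0 u v : bnbr u v -> 0 <= swap_energy u v.
Proof.
move=> /bnbrP uv; apply: expect_ge0 => // eta.
by rewrite mulr_ge0 ?sqr_ge0 // rate_ge0.
Qed.

Lemma flip_energy_ge0 u : 0 <= flip_energy u.
Proof. by apply: expect_ge0 => // eta; rewrite mulr_ge0 ?sqr_ge0 // flip_rate_ge0. Qed.

Lemma DrE : Dr c q f =
  \sum_u \sum_(v | bnbr u v) swap_energy u v + \sum_(u | boundary u) flip_energy u.
Proof.
rewrite /Dr; congr (_ + _); last exact: expect_sum.
transitivity (\sum_u expect q (fun eta : bconf d L => \sum_(v | bnbr u v)
    c (emb u) (emb v) (ext eta) * (f (bswap eta u v) - f eta) ^+ 2)).
  exact: expect_sum.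
by apply: eq_bigr => u _; exact: expect_sum.
Qed.

(** One formula dominating the cost of a step wherever it lies: inside the box, across its boundary
    or outside. Counting all swaps from [st.1] makes sums over translates easy. *)
Definition edge_energy st : R :=
  \sum_u (emb u == st.1)%:R * (\sum_(v | bnbr u v) swap_energy u v) +
  \sum_(u | boundary u) ((emb u == st.1)%:R + (emb u == target st)%:R) * flip_energy u.

Lemma edge_energy_ge0 st : 0 <= edge_energy st.
Proof.
apply: addr_ge0; apply: sumr_ge0 => u ub.
  by apply: mulr_ge0; rewrite ?ler0n //; apply: sumr_ge0 => v; exact: swap_energy_ge0.
by apply: mulr_ge0; [rewrite addr_ge0 ?ler0n | exact: flip_energy_ge0].
Qed.

Lemma swap_energy_le_edge st u v : emb u = st.1 -> emb v = target st ->
  swap_energy u v <= edge_energy st.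
Proof.
move=> ux vy; have uv : bnbr u v.
  by apply/existsP; exists st.2.1; apply/existsP; exists st.2.2; rewrite vy ux.
rewrite /edge_energy (bigD1 u) //= ux eqxx mul1r (bigD1 v) //=.
rewrite -!addrA lerDl; apply: addr_ge0.
  by apply: sumr_ge0 => w /andP[uw _]; exact: swap_energy_ge0.
apply: addr_ge0; apply: sumr_ge0 => w wb.
  by apply: mulr_ge0; rewrite ?ler0n //; apply: sumr_ge0 => v'; exact: swap_energy_ge0.
by apply: mulr_ge0; [rewrite addr_ge0 ?ler0n | exact: flip_energy_ge0].
Qed.

Lemma flip_energy_le_edge st u : boundary u -> (emb u == st.1) || (emb u == target st) ->
  flip_energy u <= edge_energy st.
Proof.
move=> ub ut; rewrite /edge_energy [X in _ <= _ + X](bigD1 u) //= addrCA.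
rewrite -[X in X <= _]addr0; apply: lerD.
  rewrite ler_peMl ?flip_energy_ge0 //.
  by case/orP: ut => ->; rewrite ?lerDl ?lerDr ?ler0n.
apply: addr_ge0; apply: sumr_ge0 => w wb.
  by apply: mulr_ge0; rewrite ?ler0n //; apply: sumr_ge0 => v'; exact: swap_energy_ge0.
by apply: mulr_ge0; [rewrite addr_ge0 ?ler0n | exact: flip_energy_ge0].
Qed.

(** As [w] varies, a given site of the box is met at most once as source and at most once as target,
    whence the factor 2. *)
Lemma sum_edge_energy st (a : site d) :
  \sum_(w : boxT d L) edge_energy (st.1 + (emb w - a), st.2) <= 2 * Dr c q f.
Proof.
have inj1 : injective (fun w : boxT d L => st.1 + (emb w - a)).
  by move=> w w' /addrI /addIr /emb_inj.
have inj2 : injective (fun w : boxT d L => target (st.1 + (emb w - a), st.2)).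
  by move=> w w'; rewrite /target /= !saddE => /addIr /inj1.
rewrite DrE /edge_energy big_split /= mulrDr; apply: lerD.
  rewrite exchange_big /= mulr_sumr; apply: ler_sum => u _; rewrite -mulr_suml.
  apply: ler_wpM2r; first by apply: sumr_ge0 => v; exact: swap_energy_ge0.
  by apply: le_trans (sum_eq_inj_le1 R _ inj1) _; rewrite ler1n.
rewrite exchange_big /= mulr_sumr; apply: ler_sum => u _; rewrite -mulr_suml.
apply: ler_wpM2r; first exact: flip_energy_ge0.
rewrite big_split /=.
have := sum_eq_inj_le1 R (emb u) inj1; have := sum_eq_inj_le1 R (emb u) inj2.
lra.
Qed.

Definition restrict_box eta : config d := ext (box_conf L eta).

(** The rate is taken with the outside emptied, as in [Dr]. A step leaving the box gets weight 1,
    since the random outer occupation already supplies the reservoir rate. *)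
Definition step_energy st eta : R :=
  (if in_lattice L st.1 && in_lattice L (target st)
   then c st.1 (target st) (restrict_box eta) else 1) *
  (f (box_conf L (swap eta st.1 (target st))) - f (box_conf L eta)) ^+ 2.

Lemma step_energy_ge0 st eta : 0 <= step_energy st eta.
Proof.
rewrite mulr_ge0 ?sqr_ge0 //; case: ifP => _ //; apply: rate_ge0; exact: nbr_target.
Qed.

Lemma step_energy_legal st eta : 1 <= c st.1 (target st) eta ->
  (f (box_conf L (swap eta st.1 (target st))) - f (box_conf L eta)) ^+ 2
  <= step_energy st eta.
Proof.
move=> c1; rewrite ler_peMl ?sqr_ge0 //; case: ifP => // _.
have [_ [_ [_ [mono _]]]] := kclg.
apply: le_trans c1 (mono _ _ _ _ (nbr_target st) _) => z.
by apply/implyP => /existsP[u /andP[/eqP <-]]; rewrite ffunE.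
Qed.

Fixpoint path_energy s eta : R :=
  if s is st :: s' then step_energy st eta + path_energy s' (swap eta st.1 (target st))
  else 0.

Lemma path_energy_ge0 s eta : 0 <= path_energy s eta.
Proof. by elim: s eta => //= st s IH eta; rewrite addr_ge0 // step_energy_ge0. Qed.

Lemma path_energy_legal s eta : legal c eta s ->
  (f (box_conf L (act eta s)) - f (box_conf L eta)) ^+ 2 <= (size s)%:R * path_energy s eta.
Proof.
elim: s eta => [|st s IH] eta /=; first by rewrite subrr expr0n mul0r.
case=> c1 /IH ls; set eta' := swap eta _ _ in ls *.
have := sqr_add_le (f (box_conf L eta') - f (box_conf L eta)) ls (path_energy_ge0 _ _).
rewrite addrC addrA subrK => /le_trans; apply.
by rewrite ler_wpM2l ?ler0n // lerD2r; exact: step_energy_legal.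
Qed.

Section Auxiliary.
Variable sl : seq (site d).
Hypothesis sl_box : forall u, emb u \in sl.

Lemma in_latticeP z : reflect (exists u, emb u = z) (in_lattice L z).
Proof. exact: 'exists_eqP. Qed.

(** Two ends in the box give a swap energy, one end gives a flip energy by [expect_on_boundary], and
    no end gives zero. *)
Lemma expect_step_energy st : st.1 \in sl -> target st \in sl ->
  expect_on q sl (step_energy st) <= edge_energy st.
Proof.
move=> xs ys; rewrite /step_energy.
have [/in_latticeP[u ux]|xo] /= := boolP (in_lattice L st.1);
  have [/in_latticeP[v vy]|yo] /= := boolP (in_lattice L (target st)).
- apply: le_trans (swap_energy_le_edge ux vy); rewrite /swap_energy.
  rewrite -(expect_on_box q sl_box) -ux -vy le_eqVlt; apply/orP; left; apply/eqP.
  by apply: eq_expect => zeta; rewrite box_conf_swap.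
- apply: le_trans (flip_energy_le_edge (u := u) _ _); last by rewrite ux eqxx.
    rewrite /flip_energy -(expect_on_boundary q sl_box f u ys yo) ux le_eqVlt.
    by apply/orP; left; apply/eqP; apply: eq_expect => zeta; rewrite mul1r.
  apply/existsP; exists st.2.1; apply/existsP; exists st.2.2; rewrite ux.
  exact: yo.
- apply: le_trans (flip_energy_le_edge (u := v) _ _); last by rewrite vy eqxx orbT.
    rewrite /flip_energy -(expect_on_boundary q sl_box f v xs xo) vy le_eqVlt.
    by apply/orP; left; apply/eqP; apply: eq_expect => zeta; rewrite mul1r swap_sym.
  apply/existsP; exists st.2.1; apply/existsP; exists (~~ st.2.2); rewrite vy.
  have -> // : sadd (target st) (dir st.2.1 (~~ st.2.2)) = st.1.
  apply/ffunP => j; rewrite /target !ffunE; case: (j == st.2.1); last by rewrite !addr0.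
  by case: (st.2.2); rewrite /= ?subrK ?addrK.
rewrite [X in X <= _](_ : _ = 0) ?edge_energy_ge0 //.
rewrite -[RHS](@expect_cst R q (seq_sub sl)); apply: eq_expect => zeta.
by rewrite box_conf_swap_out // subrr expr0n mulr0.
Qed.

(** Each swap is a fixed measure-preserving map, so every step may be evaluated at the initial
    law. *)
Lemma expect_path_energy s :
  (forall st, st \in s -> (st.1 \in sl) && (target st \in sl)) ->
  expect_on q sl (path_energy s) <= \sum_(st <- s) edge_energy st.
Proof.
elim: s => [|st s IH] hs; first by rewrite big_nil [X in X <= _]expect_cst.
have /andP[xs ys] := hs st (mem_head _ _).
rewrite big_cons [X in X <= _](_ : _ = expect_on q sl (step_energy st) +
  expect_on q sl (fun eta => path_energy s (swap eta st.1 (target st)))).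
  rewrite expect_on_swap //; apply: lerD; first exact: expect_step_energy.
  by apply: IH => st' st's; apply: hs; rewrite inE st's orbT.
by rewrite /expect_on -expectD.
Qed.

End Auxiliary.

Hypothesis q_gt0 : 0 < q.

(* The sites outside the box get independent Bernoulli occupations as well.
   Exchanging [emb u] with the outer site [y] resamples [u], and the event that
   the outer cluster [A] is empty is independent of the increment of [f]. *)
Lemma flip_energy_le_path u y (A : seq (site d)) s :
  uniq A -> ~~ in_lattice L y -> y \notin A ->
  (forall z, z \in A -> ~~ in_lattice L z) ->
  (forall eta, (forall z, z \in A -> eta z = false) ->
     legal c eta s /\ act eta s = swap eta y (emb u)) ->
  flip_energy u <= q ^- size A * ((size s)%:R * \sum_(st <- s) edge_energy st).
Proof.
move=> uA yo yA Ao hs.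
pose sl := [seq emb v | v <- enum {: boxT d L}] ++ y :: A ++ map fst s ++ map (@target d) s.
have sl_box v : emb v \in sl by rewrite mem_cat map_f // mem_enum.
have ys : y \in sl by rewrite mem_cat inE eqxx orbT.
have As : {subset A <= sl} by move=> z zA; rewrite !(mem_cat, inE) zA !orbT.
have ss st : st \in s -> (st.1 \in sl) && (target st \in sl).
  by move=> st_s; rewrite !(mem_cat, inE) !(map_f _ st_s) !orbT.
rewrite ler_pdivlMl ?exprn_gt0 //.
rewrite /flip_energy -(expect_on_boundary q sl_box f u ys yo) -expect_on_empty //; last first.
  move=> eta eta' ag; rewrite (_ : box_conf L eta = box_conf L eta').
    rewrite (_ : box_conf L (swap eta (emb u) y) = box_conf L (swap eta' (emb u) y)) //.
    apply: box_conf_agree => z zi; rewrite /swap !ag //.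
      by apply: contraTN zi; exact: Ao.
    by apply/negP => /Ao /negP; apply; apply/existsP; exists u.
  by apply: box_conf_agree => z zi; apply: ag; apply: contraTN zi; exact: Ao.
apply: le_trans (ler_wpM2l (ler0n R (size s)) (expect_path_energy sl_box ss)).
rewrite /expect_on -expectZ.
apply: le_expect => // zeta; set eta := lift_conf zeta.
(* Legality is available only when [A] is empty; otherwise the indicator kills the left side. *)
case: allP => [em|_]; last by rewrite mul0r mulr_ge0 ?ler0n ?path_energy_ge0.
have [ls as_] : legal c eta s /\ act eta s = swap eta y (emb u).
  by apply: hs => z /em /negbTE.
by rewrite mul1r swap_sym -as_; exact: path_energy_legal.
Qed.

End Energy.

Lemma dir_mulrn d (i : 'I_d) (k : nat) : dir i true *+ k = ldir k%:Z i true.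
Proof.
elim: k => [|k IH]; first by rewrite mulr0n; apply/ffunP => j; rewrite !ffunE if_same.
rewrite mulrS IH; apply/ffunP => j; rewrite !ffunE; case: (j == i); last by rewrite addr0.
by lia.
Qed.

(** * Summation over the sites of the box and the final estimate *)

Section SumOverSites.
Variables (R : realType) (d L : nat) (i : 'I_d).

Definition set_coord (u : boxT d L) (k : 'I_L) : boxT d L :=
  [ffun j => if j == i then k else u j].

(** Interchanging coordinate [i] of [u] with [k] is an involution of the pairs, which turns the left
    summand into [g u]. *)
Lemma sum_set_coord (g : boxT d L -> R) :
  \sum_u \sum_(k < L) g (set_coord u k) = L%:R * \sum_u g u.
Proof.
pose phi (p : boxT d L * 'I_L) := (set_coord p.1 p.2, p.1 i).
have phiK : involutive phi.
  move=> [u k]; rewrite /phi /= ffunE eqxx; congr (_, _).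
  by apply/ffunP => j; rewrite !ffunE; case: eqVneq => // ->.
rewrite pair_big /=; transitivity (\sum_(p : boxT d L * 'I_L) g p.1).
  by rewrite [RHS](reindex_inj (can_inj phiK)).
rewrite -(pair_big xpredT xpredT (fun u (_ : 'I_L) => g u)) /= mulr_sumr.
by apply: eq_bigr => u _; rewrite sumr_const card_ord mulr_natl.
Qed.

End SumOverSites.

Theorem mainTheorem1 (R : realType) (d : nat)
    (c : site d -> site d -> config d -> R) (Cl : seq (site d)) :
  (0 < d)%N -> is_KCLG c -> uniq Cl -> mobile_cluster c Cl ->
  exists K : R, 0 < K /\
    forall q : R, 0 < q < 1 ->
    forall (L : nat) (f : bconf d L -> R),
      Var q f <= K * q ^- (size Cl).+1 * (L%:R) ^+ 2 * Dr c q f.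
Proof.
move=> d0 kclg uCl [l [l0 moves]]; pose i := Ordinal d0.
have [[tau tauP] [E EP]] := moves i true.
pose W := unit_word tau E.
(* One factor [size W] comes from the path length, one from summing over its letters, and 2 from
   [sum_edge_energy]; [+ 1] makes positivity immediate. *)
exists (2 * (size W)%:R ^+ 2 + 1); split.
  by rewrite ltr_wpDl // mulr_ge0 // sqr_ge0.
move=> q /andP[q0 q1] L f; have q01 : 0 <= q <= 1 by rewrite !ltW.
have Dr0 : 0 <= Dr c q f.
  rewrite DrE; apply: addr_ge0; apply: sumr_ge0 => u _; last exact: flip_energy_ge0.
  by apply: sumr_ge0 => v; exact: swap_energy_ge0.
pose h := edge_energy q c f.
(* Chosen so that site 0 of the line has coordinate -1, just outside the box, and site [(u i).+1] is
   [emb u]; the cluster lies further out. *)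
pose z (u : boxT d L) : site d := emb u - ldir (l + (u i).+1)%:Z i true.
have flip_le u : flip_energy q f u <= q ^- size Cl *
    ((L * size W)%:R * \sum_(k < L) \sum_(st <- W)
       h (st.1 + (emb (set_coord i u k) - ldir l.+1%:Z i true), st.2)).
  have line_u : line i l (z u) (u i).+1 = emb u by rewrite /line subrK.
  have zi : z u i = - l.+1%:Z.
    by rewrite !ffunE eqxx; lia.
  have out (x : site d) : x i < 0 -> ~~ in_lattice L x.
    move=> xi; apply/negP => /in_latticeP[v vx]; move: xi; rewrite -vx ffunE.
    by lia.
  have y_i : line i l (z u) 0 i = -1 by rewrite line_coord zi; lia.
  pose A := [seq y + z u | y <- Cl].
  pose s := exchange_word i tau E (z u) (u i).
  have le_s : flip_energy q f u <= q ^- size A * ((size s)%:R * \sum_(st <- s) h st).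
    apply: (@flip_energy_le_path R q d L c f q01 kclg q0 u (line i l (z u) 0) A s).
    - by rewrite map_inj_uniq //; exact: addIr.
    - by apply: out; rewrite y_i.
    - by apply/mapP => -[y yC /esym/eqP]; apply/negP; exact: (line_not_cluster tauP).
    - move=> _ /mapP[y yC ->]; apply: out; rewrite site_addE zi.
      by have := cluster_coord tauP yC; lia.
    - move=> eta em; rewrite -line_u.
      apply: (exchange_wordP kclg tauP EP) => y yC; apply: em.
      by apply/mapP; exists y.
  apply: le_trans le_s _; rewrite size_map.
  apply: ler_wpM2l; first by rewrite invr_ge0 exprn_ge0 // ltW.
  have h0 st : 0 <= h st by exact: edge_energy_ge0.
  apply: ler_pM; rewrite ?ler0n //; first exact: sumr_ge0.
    rewrite ler_nat; apply: leq_trans (size_exchange_word i tau E _ _) _.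
    by rewrite leq_mul2r ltn_ord orbT.
  apply: le_trans (sum_exchange_word i tau E _ _ h0) _.
  (* Stops beyond [u i] are added by nonnegativity, so the bound depends on [u] only through its
     line in direction [i]. *)
  rewrite (big_ord_widen L (fun k =>
    \sum_(st <- W) h (st.1 + z u + dir i true *+ k, st.2))) //.
  rewrite big_mkcond; apply: ler_sum => k _; case: ifP => _; last exact: sumr_ge0.
  apply: ler_sum => st _; rewrite le_eqVlt; apply/orP; left; apply/eqP.
  congr (h (_, _)); rewrite -addrA; congr (_ + _).
  apply/ffunP => j; rewrite dir_mulrn !ffunE; have [->|ji] := eqVneq j i.
    by lia.
  by rewrite ?subr0 ?addr0.
have sum_h : \sum_u \sum_(k < L) \sum_(st <- W)
      h (st.1 + (emb (set_coord i u k) - ldir l.+1%:Z i true), st.2)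
    <= L%:R * ((size W)%:R * (2 * Dr c q f)).
  rewrite (sum_set_coord i (fun w => \sum_(st <- W)
    h (st.1 + (emb w - ldir l.+1%:Z i true), st.2))) ler_wpM2l ?ler0n //.
  rewrite exchange_big /= mulr_natl -iter_addr_0 -count_predT -big_const_seq.
  by apply: ler_sum => st _; exact: sum_edge_energy.
have Var_le : Var q f <= \sum_u flip_energy q f u by exact: (efron_stein q01 f).
apply: le_trans Var_le (le_trans (ler_sum _ (fun u _ => flip_le u)) _).
rewrite -!mulr_sumr; set X := \sum_u _ in sum_h *.
have qN0 : 0 < q ^- size Cl by rewrite invr_gt0 exprn_gt0.
(* The paths cost [q ^- size Cl]; the exponent of the claim follows from [q < 1]. *)
have qNS : q ^- size Cl <= q ^- (size Cl).+1.
  rewrite lef_pV2 ?posrE ?exprn_gt0 // exprS ler_piMl ?exprn_ge0 ?ltW //.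
have bound : (L * size W)%:R * X <=
    (2 * (size W)%:R ^+ 2 + 1) * L%:R ^+ 2 * Dr c q f.
  apply: le_trans (ler_wpM2l (ler0n _ _) sum_h) _; rewrite natrM.
  have : 0 <= L%:R ^+ 2 * Dr c q f by rewrite mulr_ge0 // sqr_ge0.
  by lra.
apply: le_trans (ler_wpM2l (ltW qN0) bound) _.
rewrite -[X in _ <= X](_ : q ^- (size Cl).+1 *
  ((2 * (size W)%:R ^+ 2 + 1) * L%:R ^+ 2 * Dr c q f) = _); last by ring.
apply: ler_wpM2r => //; rewrite !mulr_ge0 ?sqr_ge0 //.
by rewrite addr_ge0 // mulr_ge0 // sqr_ge0.
Qed.
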